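(* Let $B$ be a finitely presented group, $p$ a prime and $n\ge 1$ an integer such that the inclusion-induced map $$H_2(B^{(n-1)};\mathbb{Z}_p)\to H_2(B;\mathbb{Z}_p)$$ is surjective. Let $\{x_i\}$ be a finite set of elements of $B$ which is linearly independent in $H_1(B;\mathbb{Z}_p)$. Then the subgroup $A$ of $B$ generated by $\{x_i\}$ has the free $p$-solvable group $F/F^{(n)}$ as a quotient, where $F$ is the free group on $\{x_i\}$.
   Context: $\mathbb{Z}_p$ denotes the integers modulo $p$. For a group $G$, the derived $p$-series $\{G^{(n)}\}_{n\ge 0}$ is defined by $G^{(0)}=G$ and $G^{(n+1)}=[G^{(n)},G^{(n)}](G^{(n)})^p$, i.e. the subgroup generated by commutators and $p$-th powers of elements of $G^{(n)}$ (the prime $p$ is suppressed from the notation). ''Linearly independent in $H_1(B;\mathbb{Z}_p)$'' means that the images of the $x_i$ under $B\to H_1(B;\mathbb{Z}_p)$ are linearly independent over $\mathbb{Z}_p$. *)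

(* Defs.v *)
From HB Require Import structures.
From mathcomp Require Import all_boot all_algebra.
From mathcomp Require Import boolp classical_sets.
From mathcomp Require Import freeg.

Set Implicit Arguments.
Unset Strict Implicit.
Unset Printing Implicit Defensive.

Import GRing.Theory.

(* A subgroup of [G] is a [groupClosed G]; group homomorphisms are
   [{multiplicative G -> H}], which between groups
   preserve 1 and inverses. *)

Section Subgroups.
Local Open Scope group_scope.
Variable G : groupType.

Record subgroup (H : groupClosed G) :=
  Subgroup { subgroup_val : G; _ : subgroup_val \in H }.

Section SubgroupType.
Variable H : groupClosed G.

HB.instance Definition _ := [isSub for @subgroup_val H].
HB.instance Definition _ := [Choice of subgroup H by <:].

Fact subgroup_group_closed : group_closed H.
Proof. by split; [exact: gpred1 | exact: gpredF]. Qed.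

HB.instance Definition _ :=
  SubChoice_isSubGroup.Build G (fun x => x \in H) (subgroup H)
    subgroup_group_closed.

Fact subgroup_valM : {morph @subgroup_val H : x y / x * y}.
Proof. exact: valM. Qed.

HB.instance Definition _ :=
  isMultiplicative.Build (subgroup H) G (@subgroup_val H) subgroup_valM.
End SubgroupType.

Definition whole : {pred G} := fun=> true.

HB.instance Definition _ := isMulClosed.Build G whole (fun _ _ _ _ => isT).
HB.instance Definition _ := isMul1Closed.Build G whole isT.
HB.instance Definition _ := isInvClosed.Build G whole (fun _ _ => isT).

Section Generated.
Variable X : set G.

Definition generated : {pred G} :=
  fun g => `[< forall H : groupClosed G, (forall x, X x -> x \in H) -> g \in H >].

Fact generated1 : 1 \in generated.
Proof. by apply/asboolP => H _; exact: gpred1. Qed.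

Fact generatedM : mulg_closed generated.
Proof.
move=> a b /asboolP Ha /asboolP Hb; apply/asboolP => H XH.
by apply: gpredM; [exact: Ha | exact: Hb].
Qed.

Fact generatedV : invg_closed generated.
Proof.
by move=> a /asboolP Ha; apply/asboolP => H XH; apply: gpredVr; exact: Ha.
Qed.

HB.instance Definition _ := isMulClosed.Build G generated generatedM.
HB.instance Definition _ := isMul1Closed.Build G generated generated1.
HB.instance Definition _ := isInvClosed.Build G generated generatedV.

End Generated.

Definition normal_closure (X : set G) : groupClosed G :=
  generated [set z | exists x g, X x /\ z = x ^ g].

End Subgroups.

HB.mixin Record isConjClosed (G : groupType) (S : {pred G}) := {
  gpredJ_all : forall x g : G, x \in S -> (x ^ g)%g \in S
}.

#[short(type="normalClosed")]
HB.structure Definition NormalClosed (G : groupType) :=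
  {S of GroupClosed G S & isConjClosed G S}.

Section QuotientGroup.
Local Open Scope group_scope.
Local Open Scope quotient_scope.
Variables (G : groupType) (N : normalClosed G).

Definition coset_equiv (x y : G) : bool := x^-1 * y \in N.

Fact coset_equiv_is_equiv : equiv_class_of coset_equiv.
Proof.
rewrite /coset_equiv; split=> [x|x y|y x z].
- by rewrite mulVg gpred1.
- by rewrite -gpredV invgM invgK.
- by move=> xy yz; rewrite -(mulVKg y z) mulgA gpredM.
Qed.

Canonical coset_equiv_equiv := EquivRelPack coset_equiv_is_equiv.
Canonical coset_equiv_encModRel := defaultEncModRel coset_equiv.

Definition quotient_group := {eq_quot coset_equiv}.

HB.instance Definition _ := Choice.on quotient_group.
HB.instance Definition _ : EqQuotient G coset_equiv quotient_group :=
  EqQuotient.on quotient_group.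

Definition qg_one : quotient_group := lift_cst quotient_group 1.
Definition qg_mul := lift_op2 quotient_group *%g.
Definition qg_inv := lift_op1 quotient_group (fun x : G => x^-1).

Definition coset (x : G) : quotient_group := \pi x.

Lemma cosetK c : coset (repr c) = c. Proof. exact: reprK. Qed.

Lemma coset_eqP x y : coset x = coset y <-> x^-1 * y \in N.
Proof. by split=> [/eqquotP|?]; last exact/eqquotP. Qed.

Lemma qg_mulE x y : qg_mul (coset x) (coset y) = coset (x * y).
Proof.
unlock qg_mul; rewrite -/(coset _); apply/coset_eqP.
have /coset_eqP Hx := cosetK (coset x).
have /coset_eqP Hy := cosetK (coset y).
move: (repr (coset x)) (repr (coset y)) Hx Hy => a b Ha Hb.
have -> : (a * b)^-1 * (x * y) = (a^-1 * x) ^ b * (b^-1 * y).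
  by rewrite /conjg invgM !mulgA mulgK.
by rewrite gpredM // gpredJ_all.
Qed.

Lemma qg_invE x : qg_inv (coset x) = coset x^-1.
Proof.
unlock qg_inv; rewrite -/(coset _); apply/coset_eqP.
have /coset_eqP Hx := cosetK (coset x).
move: (repr (coset x)) Hx => a Ha.
have -> : a^-1^-1 * x^-1 = ((a^-1 * x) ^ a^-1)^-1.
  by rewrite /conjg !invgM !invgK !mulgA mulgK.
by rewrite gpredV gpredJ_all.
Qed.

Lemma qg_oneE : qg_one = coset 1. Proof. by unlock qg_one. Qed.

Fact qg_mulA : associative qg_mul.
Proof.
by move=> x y z; rewrite -[x]cosetK -[y]cosetK -[z]cosetK !qg_mulE mulgA.
Qed.

Fact qg_mul1 : left_id qg_one qg_mul.
Proof. by move=> x; rewrite -[x]cosetK qg_oneE qg_mulE mul1g. Qed.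

Fact qg_1mul : right_id qg_one qg_mul.
Proof. by move=> x; rewrite -[x]cosetK qg_oneE qg_mulE mulg1. Qed.

Fact qg_mulV : left_inverse qg_one qg_inv qg_mul.
Proof. by move=> x; rewrite -[x]cosetK qg_invE qg_mulE mulVg qg_oneE. Qed.

Fact qg_Vmul : right_inverse qg_one qg_inv qg_mul.
Proof. by move=> x; rewrite -[x]cosetK qg_invE qg_mulE mulgV qg_oneE. Qed.

HB.instance Definition _ :=
  isGroup.Build quotient_group qg_mulA qg_mul1 qg_1mul qg_mulV qg_Vmul.

Fact cosetM : {morph coset : x y / x * y}.
Proof. by move=> x y; rewrite -qg_mulE. Qed.

HB.instance Definition _ := isMultiplicative.Build G quotient_group coset cosetM.

End QuotientGroup.

Section DerivedSeries.
Local Open Scope group_scope.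
Variables (G : groupType) (p : nat).

Fixpoint derived_p (n : nat) : {pred G} :=
  if n is m.+1 then
    generated [set z | (exists x y, [/\ x \in derived_p m, y \in derived_p m
                                      & z = [~ x, y]])
                    \/ (exists2 x, x \in derived_p m & z = x ^+ p)]
  else @whole G.

Fact derived_pM n : mulg_closed (derived_p n).
Proof. by case: n => [|n] //; exact: generatedM. Qed.

Fact derived_p1 n : 1 \in derived_p n.
Proof. by case: n => [|n] //; exact: generated1. Qed.

Fact derived_pV n : invg_closed (derived_p n).
Proof. by case: n => [|n] //; exact: generatedV. Qed.

HB.instance Definition _ n := isMulClosed.Build G (derived_p n) (@derived_pM n).
HB.instance Definition _ n := isMul1Closed.Build G (derived_p n) (derived_p1 n).
HB.instance Definition _ n := isInvClosed.Build G (derived_p n) (@derived_pV n).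

Fact derived_p_conj n x g : x \in derived_p n -> x ^ g \in derived_p n.
Proof.
elim: n x g => [//|n IHn] x g /asboolP Hx; apply/asboolP => H XH.
pose HJ : {pred G} := fun z => z ^ g \in H.
have HJE z : (z \in HJ) = (z ^ g \in H) by [].
have HJ1 : 1 \in HJ by rewrite HJE conj1g gpred1.
have HJM : mulg_closed HJ.
  by move=> a b; rewrite !HJE conjMg => ? ?; rewrite gpredM.
have HJV : invg_closed HJ.
  by move=> a; rewrite !HJE conjVg => ?; rewrite gpredV.
pose m1 := isMul1Closed.Build G HJ HJ1.
pose m2 := isMulClosed.Build G HJ HJM.
pose m3 := isInvClosed.Build G HJ HJV.
pose HC : groupClosed G := HB.pack HJ m1 m2 m3.
apply: (Hx HC) => z Xz; apply: XH.
case: Xz => [[a [b [Ha Hb ->]]]|[a Ha ->]]; [left|right].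
  by exists (a ^ g), (b ^ g); rewrite conjRg; split=> //; exact: IHn.
by exists (a ^ g); [exact: IHn | rewrite conjXg].
Qed.

HB.instance Definition _ n :=
  isConjClosed.Build G (derived_p n) (@derived_p_conj n).
End DerivedSeries.

Arguments derived_p : clear implicits.

(* The elements of [free_group T] are the reduced words in the letters
   [(t, false)], which stands for t, and [(t, true)], which stands for t^-1. *)

Section FreeGroup.
Variable T : choiceType.
Implicit Types (a b : T * bool) (u v w : seq (T * bool)).

Definition inv_letter a := (a.1, ~~ a.2).

Definition reduced_word : pred (seq (T * bool)) :=
  sorted (fun a b => b != inv_letter a).

Record free_group := FreeGroup { fg_word : seq (T * bool); _ : reduced_word fg_word }.

HB.instance Definition _ := [isSub for fg_word].
HB.instance Definition _ := [Choice of free_group by <:].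

Definition push a w :=
  if w is b :: w' then if b == inv_letter a then w' else a :: w else [:: a].

Lemma inv_letterK : involutive inv_letter.
Proof. by case=> t e; rewrite /inv_letter negbK. Qed.

Lemma push_reduced a w : reduced_word w -> reduced_word (push a w).
Proof.
case: w => [//|b w] /=; case: (boolP (b == _)) => /= [_|->//].
exact: path_sorted.
Qed.

Lemma pushK a w : reduced_word w -> push a (push (inv_letter a) w) = w.
Proof.
case: w => [|b w] /=; first by rewrite eqxx.
rewrite inv_letterK; case: eqP => [->|_ _] /=; last by rewrite eqxx.
by case: w => [//|c w] /= /andP[/negbTE->].
Qed.

Lemma push_cons a w : reduced_word (a :: w) -> push a w = a :: w.
Proof. by case: w => [//|b w] /= /andP[/negbTE->]. Qed.

Definition concat u v := foldr push v u.

Lemma concat_reduced u v : reduced_word v -> reduced_word (concat u v).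
Proof. by move=> rv; elim: u => //= a u; exact: push_reduced. Qed.

Lemma concat_push a v w : reduced_word v -> reduced_word w ->
  concat (push a v) w = push a (concat v w).
Proof.
case: v => [//|b v] /= rv rw; case: eqP => [->|//].
by rewrite pushK // concat_reduced.
Qed.

Lemma concatA u v w : reduced_word v -> reduced_word w ->
  concat (concat u v) w = concat u (concat v w).
Proof.
move=> rv rw; elim: u => //= a u IHu.
by rewrite concat_push ?IHu // concat_reduced.
Qed.

Lemma concatw0 w : reduced_word w -> concat w [::] = w.
Proof.
elim: w => //= a w IHw raw; rewrite IHw; first exact: push_cons.
exact: path_sorted raw.
Qed.

Definition inv_word w := rev (map inv_letter w).

Lemma inv_word_reduced w : reduced_word w -> reduced_word (inv_word w).
Proof.
rewrite /inv_word /reduced_word rev_sorted sorted_map.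
apply: sub_sorted => a b; apply: contra_neq => E.
by rewrite -[b]inv_letterK -E.
Qed.

Lemma concat_cat u v w : concat (u ++ v) w = concat u (concat v w).
Proof. exact: foldr_cat. Qed.

Lemma concatV w : reduced_word w -> concat (inv_word w) w = [::].
Proof.
have H u v : reduced_word v -> concat (inv_word u) (concat u v) = v.
  elim: u v => [//|a u IHu] v rv.
  rewrite /inv_word /= rev_cons -cats1 concat_cat /=.
  have {2}-> : a = inv_letter (inv_letter a) by rewrite inv_letterK.
  by rewrite pushK ?concat_reduced // IHu.
by move=> rw; rewrite -{2}[w]concatw0 // H.
Qed.

Lemma inv_wordK : involutive inv_word.
Proof.
by move=> w; rewrite /inv_word map_rev revK mapK //; exact: inv_letterK.
Qed.

Definition fg_one := @FreeGroup [::] isT.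
Definition fg_mul (x y : free_group) :=
  FreeGroup (concat_reduced (fg_word x) (valP y)).
Definition fg_inv (x : free_group) := FreeGroup (inv_word_reduced (valP x)).

Fact fg_mulA : associative fg_mul.
Proof. by move=> x y z; apply/val_inj; rewrite /= concatA ?(valP y) ?(valP z). Qed.

Fact fg_mul1 : left_id fg_one fg_mul.
Proof. by move=> x; exact/val_inj. Qed.

Fact fg_1mul : right_id fg_one fg_mul.
Proof. by move=> x; apply/val_inj; rewrite /= concatw0 ?(valP x). Qed.

Fact fg_mulV : left_inverse fg_one fg_inv fg_mul.
Proof. by move=> x; apply/val_inj; rewrite /= concatV ?(valP x). Qed.

Fact fg_Vmul : right_inverse fg_one fg_inv fg_mul.
Proof.
move=> x; apply/val_inj; rewrite /= -{1}[fg_word x]inv_wordK concatV //.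
exact: (valP (fg_inv x)).
Qed.

HB.instance Definition _ :=
  isGroup.Build free_group fg_mulA fg_mul1 fg_1mul fg_mulV fg_Vmul.

Definition fg_gen (t : T) : free_group := @FreeGroup [:: (t, false)] isT.

Section UniversalProperty.
Local Open Scope group_scope.
Variables (G : groupType) (x : T -> G).

Definition letter_val a : G := if a.2 then (x a.1)^-1 else x a.1.

Definition fg_lift (w : free_group) : G := \prod_(a <- fg_word w) letter_val a.

Lemma letter_valV a : letter_val (inv_letter a) = (letter_val a)^-1.
Proof. by case: a => t []; rewrite /letter_val /= ?invgK. Qed.

Fact fg_lift_is_multiplicative : {morph fg_lift : u v / u * v}.
Proof.
move=> u v; rewrite /fg_lift /=; elim: (fg_word u) => [|a w IHw] /=.
  by rewrite big_nil mul1g.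
rewrite big_cons -mulgA -IHw; case: (concat w _) => [|b w'] /=.
  by rewrite big_seq1 big_nil mulg1.
case: eqP => [->|_]; last by rewrite big_cons.
by rewrite big_cons letter_valV mulVKg.
Qed.

HB.instance Definition _ :=
  isMultiplicative.Build free_group G fg_lift fg_lift_is_multiplicative.

Lemma fg_lift_gen t : fg_lift (fg_gen t) = x t.
Proof. by rewrite /fg_lift big_seq1. Qed.

Lemma fg_lift_unique (f : {multiplicative free_group -> G}) :
  (forall t, f (fg_gen t) = x t) -> f =1 fg_lift.
Proof.
move=> fx [w rw]; rewrite /fg_lift /=.
have f1 : f 1 = 1 by apply: (@mulgI _ (f 1)); rewrite -gmulfM !mulg1.
elim: w rw => [|a w IHw] raw; first by rewrite big_nil -f1; congr (f _); exact: val_inj.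
have rw := path_sorted raw; rewrite big_cons -(IHw rw).
have -> : letter_val a = f (@FreeGroup [:: a] isT).
  case: a {raw} => t []; rewrite /letter_val /= -fx; last by congr (f _); exact: val_inj.
  apply: (@mulgI _ (f (fg_gen t))); rewrite mulgV -gmulfM -f1; congr (f _).
  by apply: val_inj; rewrite /= /inv_letter /= eqxx.
by rewrite -gmulfM; congr (f _); apply: val_inj; rewrite /= push_cons.
Qed.
End UniversalProperty.

End FreeGroup.

Definition finitely_presented (G : groupType) : Prop :=
  exists (m : nat) (rels : seq (free_group 'I_m))
         (f : {multiplicative free_group 'I_m -> G}),
    (forall g : G, exists w, f w = g) /\
    (forall w, f w = 1%g <-> w \in normal_closure [set` rels]).

Local Open Scope ring_scope.

Section LinearExtension.
Variables (R : nzRingType) (K : choiceType) (M : lmodType R) (f : K -> M).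

HB.instance Definition _ :=
  GRing.isZmodMorphism.Build {freeg K / R} M (fglift f) (lift_is_additive f).

Fact fglift_scalable : scalable (fglift f).
Proof.
have scaleU (c k : R) x : c *: << k *g x >> = << (c * k) *g x >> :> {freeg K / R}.
  by apply/eqP/freeg_eqP => y; rewrite coeffZ !coeffU mulrA.
move=> c D; rewrite -(freeg_sumE D) scaler_sumr 2!raddf_sum /= scaler_sumr.
by apply: eq_bigr => x _; rewrite scaleU !liftU scalerA.
Qed.

HB.instance Definition _ :=
  GRing.isScalable.Build R {freeg K / R} M *:%R (fglift f) fglift_scalable.
End LinearExtension.

Section BarComplex.
Variables (R : nzRingType) (G : groupType).

(* Inhomogeneous, unnormalized bar complex with coefficients in the trivial
   module R: the basis element t in degree n is [t 0|...|t (n-1)]. *)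
Definition chain (n : nat) := {freeg {ffun 'I_n -> G} / R}.

(* The i-th face of [g_1|...|g_n+1]: it deletes g_1 if i = 0, deletes g_n+1 if
   i = n + 1, and multiplies g_i by g_i+1 otherwise. Beware that t is indexed
   from 0. *)
Definition face n (i : 'I_n.+2) (t : {ffun 'I_n.+1 -> G}) : {ffun 'I_n -> G} :=
  [ffun j : 'I_n =>
    let g := t (widen_ord (leqnSn n) j) in
    let g' := t (fintype.lift ord0 j) in
    if (j.+1 < i)%N then g else if j.+1 == i then (g * g')%g else g'].

Definition bar_boundary n : chain n -> chain n.-1 :=
  if n is m.+1 then
    fglift (fun t => \sum_(i < m.+2) (-1) ^+ i *: << face i t >>)
  else fun=> 0.

Fact bar_boundary_linear n : linear (@bar_boundary n).
Proof.
case: n => [|n] c x y /=; first by rewrite scaler0 addr0.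
by rewrite linearP.
Qed.

HB.instance Definition _ n :=
  GRing.isLinear.Build R (chain n) (chain n.-1) *:%R (@bar_boundary n)
    (@bar_boundary_linear n).

Definition is_cycle n : {pred chain n} := fun c => bar_boundary c == 0.

Fact is_cycle_submod n : submod_closed (@is_cycle n).
Proof.
split; first by rewrite unfold_in raddf0.
move=> a x y; rewrite !unfold_in => /eqP Hx /eqP Hy.
by rewrite bar_boundary_linear Hx Hy scaler0 addr0.
Qed.

HB.instance Definition _ n :=
  GRing.isSubmodClosed.Build R (chain n) (@is_cycle n) (@is_cycle_submod n).

Record cycle n := Cycle { cycle_val : chain n; _ : cycle_val \in @is_cycle n }.

HB.instance Definition _ n := [isSub for @cycle_val n].
HB.instance Definition _ n := [Choice of cycle n by <:].
HB.instance Definition _ n := [SubChoice_isSubLmodule of cycle n by <:].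
Section BarHomology.
Variable n : nat.

(* This is the whole image of the boundary map, because bar_boundary has square
   zero. *)
Definition is_boundary : {pred cycle n} :=
  fun z => `[< exists c : chain n.+1, bar_boundary c = cycle_val z >].

Fact is_boundary_submod : submod_closed is_boundary.
Proof.
split; first by apply/asboolP; exists 0; rewrite raddf0.
move=> a x y /asboolP[c Hc] /asboolP[d Hd]; apply/asboolP.
by exists (a *: c + d); rewrite bar_boundary_linear Hc Hd.
Qed.

HB.instance Definition _ :=
  GRing.isSubmodClosed.Build R (cycle n) is_boundary is_boundary_submod.

Definition homology := Quotient.quot is_boundary.

HB.instance Definition _ := GRing.Zmodule.on homology.

Definition homology_class (z : cycle n) : homology := \pi%qT z.

Lemma homology_classP z z' :
  homology_class z = homology_class z' <-> z - z' \in is_boundary.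
Proof. by split=> [/eqquotP|?]; last exact/eqquotP. Qed.

Lemma homology_classK h : homology_class (repr h) = h.
Proof. exact: reprK. Qed.

Definition homology_scale (a : R) (h : homology) : homology :=
  homology_class (a *: repr h).

Lemma homology_class_additive : zmod_morphism homology_class.
Proof. by move=> x y; rewrite /homology_class !piE. Qed.

HB.instance Definition _ :=
  GRing.isZmodMorphism.Build (cycle n) homology homology_class
    homology_class_additive.

Lemma homology_scaleE a z :
  homology_scale a (homology_class z) = homology_class (a *: z).
Proof.
apply/homology_classP; rewrite -scalerBr rpredZ //.
by apply/homology_classP; rewrite homology_classK.
Qed.

Fact homology_scaleA a b h :
  homology_scale a (homology_scale b h) = homology_scale (a * b) h.
Proof. by rewrite -[h]homology_classK !homology_scaleE scalerA. Qed.

Fact homology_scale1 : left_id 1 homology_scale.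
Proof.
by move=> h; rewrite -[h]homology_classK homology_scaleE scale1r.
Qed.

Fact homology_scaleDr : right_distributive homology_scale +%R.
Proof.
move=> a h k; rewrite -[h]homology_classK -[k]homology_classK.
by rewrite -raddfD !homology_scaleE scalerDr raddfD.
Qed.

Fact homology_scaleDl h : {morph homology_scale^~ h : a b / a + b}.
Proof.
move=> a b; rewrite -[h]homology_classK !homology_scaleE.
by rewrite scalerDl raddfD.
Qed.

HB.instance Definition _ := GRing.Zmodule_isLmodule.Build R homology
  homology_scaleA homology_scale1 homology_scaleDr homology_scaleDl.

Fact homology_class_scalable : scalable homology_class.
Proof. by move=> a z; rewrite -homology_scaleE. Qed.

HB.instance Definition _ :=
  GRing.isScalable.Build R (cycle n) homology *:%R homology_class
    homology_class_scalable.
End BarHomology.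

Fact bar1_cycle (g : G) : << [ffun=> g] >> \in @is_cycle 1.
Proof.
rewrite unfold_in /bar_boundary liftU scale1r big_ord_recl big_ord1 /=.
rewrite expr0 expr1 scale1r scaleN1r subr_eq0; apply/eqP.
by congr (<< _ >>); apply/ffunP => -[].
Qed.

(* The natural map G -> H_1(G; R), which sends g to the class of the bar
   cycle [g]. *)
Definition H1_class (g : G) : homology 1 := homology_class (Cycle (bar1_cycle g)).

End BarComplex.

Arguments homology : clear implicits.
Arguments H1_class R {G} g.

Section Functoriality.
Variables (R : nzRingType) (G H : groupType) (f : {multiplicative G -> H}).

Definition chain_map_basis n (t : {ffun 'I_n -> G}) : chain R H n :=
  << [ffun i => f (t i)] : {ffun 'I_n -> H} >>.

Definition chain_map n : chain R G n -> chain R H n :=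
  fglift (@chain_map_basis n).

HB.instance Definition _ n :=
  GRing.Linear.copy (@chain_map n) (fglift (@chain_map_basis n)).

Lemma chain_map_boundary n (c : chain R G n) :
  bar_boundary (chain_map c) = chain_map (bar_boundary c).
Proof.
case: n c => [|n] c; first by rewrite /= raddf0.
rewrite -(freeg_sumE c) !raddf_sum /=; apply: eq_bigr => t _.
have U (k : R) m (u : {ffun 'I_m -> G}) :
  chain_map << k *g u >> = k *: chain_map_basis u by exact: liftU.
rewrite U linearZ /= !liftU scale1r linearZ /=; congr (_ *: _).
rewrite raddf_sum /=; apply: eq_bigr => i _; rewrite linearZ /= U scale1r.
congr (_ *: << _ >>); apply/ffunP => j; rewrite !ffunE.
by rewrite /=; case: ifP => _ //; case: ifP => _ //; rewrite gmulfM.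
Qed.

Fact cycle_map_subproof n (z : cycle R G n) :
  chain_map (cycle_val z) \in @is_cycle R H n.
Proof.
by rewrite unfold_in chain_map_boundary (eqP (valP z)) raddf0.
Qed.

Definition cycle_map n (z : cycle R G n) : cycle R H n :=
  Cycle (cycle_map_subproof z).

Definition homology_map n (h : homology R G n) : homology R H n :=
  homology_class (cycle_map (repr h)).

(* The choice of representative in homology_map does not matter. *)
Lemma homology_mapE n (z : cycle R G n) :
  homology_map (homology_class z) = homology_class (cycle_map z).
Proof.
apply/homology_classP.
have /homology_classP/asboolP[c Hc] := homology_classK (homology_class z).
apply/asboolP; exists (chain_map c).
by rewrite chain_map_boundary Hc !raddfB.
Qed.
End Functoriality.

Definition lin_indep (R : nzRingType) (M : lmodType R) (k : nat)
    (v : 'I_k -> M) : Prop :=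
  forall a : 'I_k -> R, \sum_(i < k) a i *: v i = 0 -> forall i, a i = 0.

(* Main.v *)
Require Import Defs.
From HB Require Import structures.
From mathcomp Require Import all_boot all_algebra.
From mathcomp Require Import boolp classical_sets.
From mathcomp Require Import freeg ring.
From mathcomp Require all_fingroup all_solvable.

(** Write [n = m + 1], [F] for the free group on the [x i], and [P = F / F^(n)].
    The map from [A] onto [P] is the restriction of a homomorphism [B -> P] that
    sends [x i] to the class of the generator [i]; such a map is onto as soon as
    it exists. So the theorem is an extension problem for maps out of [F] along
    [F -> B], and this is solved for every finite group [P] with [P^(n)] trivial
    and every choice of the images of the [x i] ([extend_to_finite]).

    Such a [P] is a finite [p]-group. Choose [z] central of order [p]; by
    induction on the order of [P] there is a map [B -> P / <z>], and one must lift
    it through a central extension by [F_p]. The obstruction is a class in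
    [H^2(B; F_p)]. On [B^(m)] it vanishes: the image of [B^(m)] lies in the image
    of [W = P^(m) <z>], which is elementary abelian because [P^(m+1)] is trivial
    and [z] is central of order [p], and an elementary abelian group splits over
    any subgroup. The surjectivity of [H_2(B^(m)) -> H_2(B)] says dually that
    restriction from [H^2(B)] to [H^2(B^(m))] is injective
    ([coboundary2_descent]), so the lift exists. It has the right values on the
    [x i] up to powers of [z], and these are corrected by a homomorphism
    [B -> F_p], which exists because the [x i] are independent in first homology
    ([hom_prescribed]). Both dualities rest on [linear_factor].

    Finally [F / F^(n)] is finite: by Schreier's argument each [F^(j)] is finitely
    generated, so each quotient [F^(j) / F^(j+1)] is a finite elementary abelian
    group ([derived_p_fin_index]). *)

Set Implicit Arguments.
Unset Strict Implicit.
Unset Printing Implicit Defensive.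

Import GRing.Theory.

(** * Extension of linear maps *)

Section LinearFactorization.
Local Open Scope classical_set_scope.
Local Open Scope ring_scope.
Variables (K : fieldType) (M N V : lmodType K).
Implicit Types (A X : set (N * V)) (d : N) (v : V).

(** The graph of a linear map from a subspace of [N] to [V]; a partial map as a
    set of pairs makes the union of a chain of extensions a plain union. *)
Definition linear_graph A : Prop :=
  (forall a x y, A x -> A y -> A (a *: x + y)) /\ (forall v, A (0, v) -> v = 0).

Lemma linear_graph_fun A d v w : linear_graph A -> A (d, v) -> A (d, w) -> v = w.
Proof.
move=> [linA funA] Av Aw; apply/eqP; rewrite eq_sym -subr_eq0; apply/eqP/funA.
have : A (-1 *: d + d, -1 *: v + w) by exact: (linA _ _ _ Av Aw).
by rewrite !scaleN1r addNr addrC.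
Qed.

(** Zorn's lemma; [N] is a chain space or a homology group of an arbitrary
    group, so that no finite basis is at hand. *)
Lemma linear_graph_extend A :
  A (0, 0) -> linear_graph A ->
  exists B, [/\ A `<=` B, linear_graph B & forall d, exists v, B (d, v)].
Proof.
move=> A0 gA.
(* Maximality is asked of the sets A `|` X, because the empty chain has an empty
   union and the graph must still contain A. *)
have [F Fchain Ftot|X [gX maxX]] :=
    @Zorn_bigcup (N * V)%type (fun X => linear_graph (A `|` X)).
  split=> [a x y Ux Uy|v].
    have [Z [ZU gZ [Zx Zy]]] : exists Z,
        [/\ A `|` Z `<=` A `|` \bigcup_(X in F) X,
            linear_graph (A `|` Z) & (A `|` Z) x /\ (A `|` Z) y].
      case: Ux Uy => [Ax|[X FX Xx]] [Ay|[Y FY Yy]].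
      - by exists set0; rewrite setU0.
      - exists Y; split; first exact: setUS (@bigcup_sup _ _ _ _ (fun X => X) FY).
          exact: Fchain.
        by split; [left|right].
      - exists X; split; first exact: setUS (@bigcup_sup _ _ _ _ (fun X => X) FX).
          exact: Fchain.
        by split; [right|left].
      - case: (Ftot _ _ FX FY) => [XY|YX].
        + exists Y; split; first exact: setUS (@bigcup_sup _ _ _ _ (fun X => X) FY).
            exact: Fchain.
          by split; right=> //; exact: XY.
        + exists X; split; first exact: setUS (@bigcup_sup _ _ _ _ (fun X => X) FX).
            exact: Fchain.
          by split; right=> //; exact: YX.
    by apply: ZU; case: gZ => linZ _; exact: linZ.
  case=> [/(proj2 gA)//|[X FX Xv]].
  by apply: (proj2 (Fchain _ FX)); right.
exists (A `|` X); split=> //.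
move=> d; apply: contrapT => noext.
have [linX funX] := gX.
(* If d is not in the domain, the graph extends by sending d to 0. *)
pose Y : set (N * V) := [set y | exists c x, (A `|` X) x /\ y = c *: (d, 0) + x].
have AXY : (A `|` X `<=` Y).
  by move=> x AXx; exists 0, x; rewrite scale0r add0r.
apply: (maxX Y).
  split; first by move=> x Xx; apply: AXY; right.
  move=> YX; apply: noext; exists 0; right; apply: YX.
  by exists 1, (0, 0); split; [left|rewrite scale1r addr0].
rewrite (_ : A `|` Y = Y); last first.
  by apply/seteqP; split=> [y [Ay|//]|y Yy]; [apply: AXY; left|right].
split=> [a _ _ [c [x [AXx ->]]] [c' [x' [AXx' ->]]]|v [c [[x w] [AXx [E1 E2]]]]].
  exists (a * c + c'), (a *: x + x'); split; first exact: linX.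
  by rewrite scalerDr scalerA scalerDl addrACA.
have c0 : c = 0.
  apply/eqP/negP => /negP c0; apply: noext; exists (- c^-1 *: w).
  have := linX (- c^-1) _ _ AXx (or_introl A0).
  rewrite addr0; congr ((A `|` X) (_, _)).
  have /eqP -> : x == - (c *: d) by rewrite -addr_eq0 addrC -E1.
  by rewrite scaleNr scalerN opprK scalerA mulVf // scale1r.
move: E1 E2; rewrite c0 !scale0r !add0r => E1 ->.
by apply: funX; rewrite E1.
Qed.

(** This is how a vanishing statement on cycles becomes the existence of a
    cochain: take for [f] the boundary map and for [g] a cochain. *)
Lemma linear_factor (f : {linear M -> N}) (g : {linear M -> V}) :
  (forall m, f m = 0 -> g m = 0) ->
  exists h : {linear N -> V}, forall m, h (f m) = g m.
Proof.
move=> fg.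
pose A : set (N * V) := [set (f m, g m) | m in setT].
have A0 : A (0, 0) by exists 0; rewrite ?raddf0.
have gA : linear_graph A.
  split=> [a _ _ [m _ <-] [m' _ <-]|v [m _ [/fg gm <-]]//].
  by exists (a *: m + m'); rewrite ?linearP.
have [B [AB gB /choice[h hB]]] := linear_graph_extend A0 gA.
have linh : linear h.
  move=> a x y; apply: (linear_graph_fun gB (hB _)).
  exact: (proj1 gB a _ _ (hB x) (hB y)).
pose hl := GRing.isLinear.Build K N V *:%R h linh.
pose H : {linear N -> V} := HB.pack h hl.
exists H => m; apply: (linear_graph_fun gB (hB _)).
by apply: AB; exists m.
Qed.

End LinearFactorization.

(** * Low-dimensional cochains *)

Section Cochains.
Local Open Scope ring_scope.
Variables (K : fieldType) (G : groupType).

Definition bar1 (a : G) : {ffun 'I_1 -> G} := [ffun=> a].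
Definition bar2 (a b : G) : {ffun 'I_2 -> G} :=
  [ffun i : 'I_2 => if i == ord0 then a else b].

Lemma bar2E (t : {ffun 'I_2 -> G}) : bar2 (t ord0) (t ord_max) = t.
Proof.
by apply/ffunP => -[[|[|//]] lti]; rewrite ffunE /=; congr (t _); exact: val_inj.
Qed.

Lemma boundary_bar2 a b :
  bar_boundary << bar2 a b >> = << bar1 b >> - << bar1 (a * b)%g >> + << bar1 a >>
    :> chain K G 1.
Proof.
rewrite /bar_boundary liftU scale1r !big_ord_recl big_ord0 /=.
rewrite expr0 !exprS expr0 !mulr1 mulrNN mulr1 !scale1r scaleN1r addr0 addrA.
by congr (<< _ >> - << _ >> + << _ >>); apply/ffunP => -[[]] //= ?; rewrite !ffunE.
Qed.

Definition bar3 (a b c : G) : {ffun 'I_3 -> G} :=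
  [ffun i : 'I_3 => if i == ord0 then a else if i == ord_max then c else b].

Lemma bar3E (t : {ffun 'I_3 -> G}) :
  t = bar3 (t ord0) (t (inord 1)) (t ord_max).
Proof.
apply/ffunP => -[[|[|[|//]]] lti]; rewrite ffunE /=; congr (t _); apply: val_inj => //=.
by rewrite inordK.
Qed.

Lemma boundary_bar3 a b c :
  bar_boundary << bar3 a b c >> =
    << bar2 b c >> - << bar2 (a * b)%g c >> + << bar2 a (b * c)%g >> - << bar2 a b >>
    :> chain K G 2.
Proof.
rewrite /bar_boundary liftU scale1r !big_ord_recl big_ord0 /=.
rewrite expr0 !exprS expr0 !mulr1 !mulrNN !mulr1 !scale1r !scaleN1r addr0 !addrA.
by congr (<< _ >> - << _ >> + << _ >> - << _ >>);
  apply/ffunP => -[[|[|//]] lti]; rewrite !ffunE.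
Qed.

Lemma chain_linear_ext n (V : lmodType K) (f g : {linear chain K G n -> V}) :
  (forall t, f << t >> = g << t >>) -> f =1 g.
Proof.
move=> fg c; rewrite -(freeg_sumE c) !raddf_sum /=; apply: eq_bigr => t _.
have -> : << coeff t c *g t >> = coeff t c *: << t >> :> chain K G n.
  by apply/eqP/freeg_eqP => y; rewrite coeffZ !coeffU mul1r.
by rewrite !linearZ fg.
Qed.

Definition cochain1 (s : G -> K) : chain K G 1 -> K^o :=
  fglift (fun t : {ffun 'I_1 -> G} => s (t ord0) : K^o).

Definition cochain2 (e : G -> G -> K) : chain K G 2 -> K^o :=
  fglift (fun t : {ffun 'I_2 -> G} => e (t ord0) (t ord_max) : K^o).

HB.instance Definition _ s := GRing.Linear.copy (cochain1 s)
  (fglift (fun t : {ffun 'I_1 -> G} => s (t ord0) : K^o)).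
HB.instance Definition _ e := GRing.Linear.copy (cochain2 e)
  (fglift (fun t : {ffun 'I_2 -> G} => e (t ord0) (t ord_max) : K^o)).

Lemma cochain1E s a : cochain1 s << bar1 a >> = s a.
Proof. by rewrite /cochain1 /= liftU scale1r ffunE. Qed.

Lemma cochain2E e a b : cochain2 e << bar2 a b >> = e a b.
Proof. by rewrite /cochain2 /= liftU scale1r !ffunE. Qed.

(** The identity satisfied by the discrepancy of a set-theoretic section of a
    central extension. *)
Definition cocycle2 (e : G -> G -> K) : Prop :=
  forall a b c, e a b + e (a * b)%g c = e b c + e a (b * c)%g.

Definition coboundary2 (e : G -> G -> K) : Prop :=
  exists s : G -> K, forall a b, e a b = s a + s b - s (a * b)%g.

Lemma cocycle2_boundary e (c : chain K G 3) :
  cocycle2 e -> cochain2 e (bar_boundary c) = 0.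
Proof.
move=> ecoc; apply: (@chain_linear_ext _ _ (cochain2 e \o @bar_boundary K G 3) \0) => t.
rewrite [t]bar3E -[LHS]/(cochain2 e (@bar_boundary K G 3 _)) boundary_bar3.
rewrite !raddfB raddfD raddfB /= !cochain2E.
have := ecoc (t ord0) (t (inord 1)) (t ord_max).
move/eqP; rewrite addrC -subr_eq => /eqP<-.
by ring.
Qed.

Lemma H1_classM (a b : G) : H1_class K (a * b)%g = H1_class K a + H1_class K b.
Proof.
rewrite /H1_class -raddfD; apply/homology_classP/asboolP.
exists (- << bar2 a b >>).
transitivity (- (@bar_boundary K G 2 << bar2 a b >>)); first exact: raddfN.
rewrite boundary_bar2 opprD opprB -addrA -opprD.
by rewrite [X in _ - X]addrC.
Qed.

(** Independence makes the coordinates on the span of the classes of the [x i]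
    well defined; a linear form with prescribed values there extends to all of
    first homology, and its composite with [H1_class] is a homomorphism. *)
Lemma hom_prescribed k (x : 'I_k -> G) (c : 'I_k -> K) :
  lin_indep (fun i => H1_class K (x i)) ->
  exists chi : G -> K,
    (forall a b, chi (a * b)%g = chi a + chi b) /\ (forall i, chi (x i) = c i).
Proof.
move=> indep.
pose f (v : 'rV[K]_k) := \sum_i v 0 i *: H1_class K (x i).
pose g (v : 'rV[K]_k) : K^o := \sum_i v 0 i * c i.
have linf : linear f.
  move=> a u v; rewrite scaler_sumr -big_split; apply: eq_bigr => i _.
  by rewrite !mxE scalerDl scalerA.
have ling : linear g.
  move=> a u v; rewrite scaler_sumr -big_split; apply: eq_bigr => i _.
  by rewrite !mxE mulrDl -mulrA.
pose mf := GRing.isLinear.Build K _ _ _ f linf.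
pose F : {linear 'rV[K]_k -> homology K G 1} := HB.pack f mf.
pose mg := GRing.isLinear.Build K _ _ _ g ling.
pose E : {linear 'rV[K]_k -> K^o} := HB.pack g mg.
have [v /indep v0|h hF] := @linear_factor _ _ _ _ F E.
  by rewrite /E /= /g big1 // => i _; rewrite v0 mul0r.
exists (fun a => h (H1_class K a)); split=> [a b|i].
  by rewrite H1_classM raddfD.
have := hF (delta_mx 0 i); rewrite /F /E /= /f /g.
rewrite (bigD1 i) //= big1 => [|j /negbTE ji]; last by rewrite mxE ji andbF scale0r.
rewrite (bigD1 i) //= big1 => [|j /negbTE ji]; last by rewrite mxE ji andbF mul0r.
by rewrite !mxE !eqxx !addr0 scale1r mul1r.
Qed.
End Cochains.

Section Obstruction.
Local Open Scope ring_scope.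

Lemma chain_map_bar2 (K : fieldType) (G H : groupType)
    (f : {multiplicative H -> G}) a b :
  chain_map f << bar2 a b >> = << bar2 (f a) (f b) >> :> chain K G 2.
Proof.
transitivity (1 *: @chain_map_basis K _ _ f _ (bar2 a b)); first exact: liftU.
rewrite scale1r; congr (<< _ >>); apply/ffunP => i; rewrite !ffunE.
by case: ifP.
Qed.

(** The dual of surjectivity in second homology, namely injectivity of the
    restriction in second cohomology. Every 2-cycle of [G] is a boundary plus the
    image of a cycle of [H]; a cocycle vanishes on the former, and on the latter
    because it is a coboundary there. So it vanishes on all 2-cycles of [G], that
    is, it factors through the boundary map. *)
Lemma coboundary2_descent (K : fieldType) (G H : groupType)
    (f : {multiplicative H -> G}) (e : G -> G -> K) :
  (forall y : homology K G 2, exists z : homology K H 2, homology_map f z = y) ->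
  cocycle2 e -> coboundary2 (fun a b => e (f a) (f b)) -> coboundary2 e.
Proof.
move=> surj ecoc [s es].
have pull : forall c, cochain2 e (chain_map f c) = cochain1 s (bar_boundary c).
  apply: (@chain_linear_ext _ _ _ _ (cochain2 e \o @chain_map _ _ _ f 2)
     (cochain1 s \o @bar_boundary K H 2)) => t.
  rewrite -[t]bar2E -[RHS]/(cochain1 s (@bar_boundary K H 2 _)) boundary_bar2.
  rewrite raddfD raddfB /= !cochain1E.
  rewrite chain_map_bar2 cochain2E es.
  by ring.
have [m m0|h hE] := @linear_factor _ _ _ _ (@bar_boundary K G 2) (cochain2 e).
  have mcyc : m \in @is_cycle K G 2 by apply/eqP.
  have [z zm] := surj (homology_class (Cycle mcyc)).
  have [[z' zcyc] zE] : exists z', homology_class z' = z.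
    by eexists; exact: homology_classK.
  move: zm; rewrite -zE homology_mapE.
  move=> /homology_classP/asboolP[c].
  move=> /= /(congr1 (cochain2 e)).
  rewrite cocycle2_boundary // raddfB /= pull (eqP zcyc) raddf0 sub0r.
  by move/eqP; rewrite eq_sym oppr_eq0 => /eqP.
exists (fun a => h << bar1 a >>) => a b.
transitivity (h (<< bar1 b >> - << bar1 (a * b)%g >> + << bar1 a >>)).
  rewrite -[LHS](cochain2E e) -hE; congr (h _); exact: boundary_bar2.
by rewrite raddfD raddfB /=; ring.
Qed.
End Obstruction.

(** * Homomorphisms, generation and the derived p-series *)

Section GroupMorphisms.
Local Open Scope group_scope.
Variables (G H : groupType) (f : {multiplicative G -> H}).

Lemma multiplicative1 : f 1 = 1.
Proof. by apply: (@mulgI _ (f 1)); rewrite -gmulfM !mulg1. Qed.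

Definition group_morphism : UMagmaMorphism.type G H :=
  HB.pack (Multiplicative.sort f)
    (Multiplicative_isUMagmaMorphism.Build G H _ multiplicative1).

Lemma multiplicativeV a : f a^-1 = (f a)^-1.
Proof. exact: (gmulfV group_morphism). Qed.

Lemma multiplicativeX a n : f (a ^+ n) = f a ^+ n.
Proof. exact: (gmulfXn group_morphism). Qed.

Lemma multiplicativeR a b : f [~ a, b] = [~ f a, f b].
Proof. exact: (gmulfR group_morphism). Qed.
End GroupMorphisms.

Section GeneratedSubgroups.
Local Open Scope group_scope.
Variable G : groupType.
Implicit Types (X : set G) (S T : seq G) (H N : groupClosed G).

Lemma mem_generated X x : X x -> x \in generated X.
Proof. by move=> Xx; apply/asboolP => H; exact. Qed.

Lemma generated_ind X (P : G -> Prop) :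
  P 1 -> (forall a b, P a -> P b -> P (a * b)) -> (forall a, P a -> P a^-1) ->
  (forall x, X x -> P x) -> forall g, g \in generated X -> P g.
Proof.
move=> P1 PM PV PX g /asboolP gX.
pose S : {pred G} := fun a => `[< P a >].
have S1 : 1 \in S by apply/asboolP.
have SM : mulg_closed S by move=> a b /asboolP Pa /asboolP Pb; apply/asboolP/PM.
have SV : invg_closed S by move=> a /asboolP Pa; apply/asboolP/PV.
pose m1 := isMul1Closed.Build G S S1.
pose m2 := isMulClosed.Build G S SM.
pose m3 := isInvClosed.Build G S SV.
pose SC : groupClosed G := HB.pack S m1 m2 m3.
by apply/asboolP; apply: (gX SC) => x Xx; apply/asboolP/PX.
Qed.

(** [T] contains representatives of all right cosets of [N] that meet [A];
    repetitions are allowed, since only finiteness matters. *)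
Definition covers (T : seq G) (N A : {pred G}) :=
  forall g, g \in A -> exists2 t, t \in T & g / t \in N.

Definition fin_gen (A : {pred G}) :=
  exists2 S : seq G, {subset S <= A} & {subset A <= generated [set` S]}.

(** Schreier's argument. With [U] a list of representatives of the right cosets,
    moving a generator past a representative costs an element
    [u * s / rep (u * s)] of [H], so that every element is a product of such
    elements times a representative. *)
Lemma schreier H T : fin_gen (@whole G) -> covers T H (@whole G) -> fin_gen H.
Proof.
move=> [S _ genS] covT.
have /choice[rep repP] : forall g, exists t, t \in T /\ g / t \in H.
  by move=> g; have [//|t Tt Hgt] := covT g; exists t.
(* The representative 1 starts the rewriting of an element of H. The list S2 is
   closed under inverses because transport only moves generators one by one. *)
pose U := 1 :: T; pose S2 := S ++ [seq s^-1 | s <- S].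
pose L := [seq u * s / rep (u * s) | u <- U, s <- S2] ++ [seq u <- U | u \in H].
have transport (s u : G) : s \in S2 -> u \in U ->
    exists2 u' : G, u' \in U & u * s / u' \in generated [set` L].
  move=> S2s Uu; exists (rep (u * s)).
    by rewrite inE; case: (repP (u * s)) => ->; rewrite orbT.
  apply: mem_generated; rewrite /= mem_cat; apply/orP; left.
  by apply/allpairsP; exists (u, s).
pose P (g : G) := forall u : G, u \in U ->
  exists2 u' : G, u' \in U & u * g / u' \in generated [set` L].
have P1 : P 1 by move=> u Uu; exists u; rewrite // mulg1 mulgV gpred1.
have PM a b : P a -> P b -> P (a * b).
  move=> Pa Pb u /Pa[u' /Pb[u'' Uu'' Lb] La]; exists u'' => //.
  have -> : u * (a * b) / u'' = (u * a / u') * (u' * b / u'').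
    by rewrite !mulgA mulgVK.
  exact: gpredM.
have allP g : P g /\ P g^-1.
  have : g \in generated [set` S] by exact: genS.
  elim/generated_ind: g / => [|a b [Pa PVa] [Pb PVb]|a []|s /= Ss].
  - by rewrite invg1.
  - by rewrite invgM; split; exact: PM.
  - by rewrite invgK.
  by split=> u; apply: transport; rewrite mem_cat ?Ss // map_f ?orbT.
exists L => [x|h Hh].
  rewrite mem_cat => /orP[/allpairsP[[u s] [_ _ ->]]|]; last first.
    by rewrite mem_filter => /andP[].
  by case: (repP (u * s)).
have [//|u Uu] := (allP h).1 1; first by rewrite inE eqxx.
rewrite mul1g => Lhu; have LH : {subset generated [set` L] <= H}.
  move=> g /asboolP; apply=> x; rewrite /= mem_cat.
  case/orP=> [/allpairsP[[v s] [_ _ ->]]|]; last by rewrite mem_filter => /andP[].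
  by case: (repP (v * s)).
have Hu : u \in H by rewrite -(gpredFl u Hh) LH.
rewrite -[h](mulgVK u) gpredM //; apply: mem_generated.
by rewrite /= mem_cat mem_filter Hu Uu orbT.
Qed.

(** A finitely generated abelian group of exponent [p] is finite: each generator
    contributes a power with exponent below [p]. *)
Lemma finite_elementary p S : (0 < p)%N ->
  {in S &, forall a b, commute a b} -> {in S, forall a, a ^+ p = 1} ->
  exists R : seq G, {subset generated [set` S] <= R}.
Proof.
move=> p0; elim: S => [|s S IHS] comS expS.
  exists [:: 1] => g; elim/generated_ind: g / => [|a b|a|//]; rewrite !inE //.
    by move=> /eqP-> /eqP->; rewrite mulg1.
  by move=> /eqP->; rewrite invg1.
have [a b Sa Sb|a Sa|R RS] := IHS.
- by apply: comS; rewrite inE (Sa, Sb) orbT.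
- by apply: expS; rewrite inE Sa orbT.
have sp : s ^+ p = 1 by apply: expS; rewrite inE eqxx.
have coms r : r \in generated [set` S] -> commute s r.
  elim/generated_ind: r / => [|a b|a|a /= Sa]; first exact: commute1.
  - exact: commuteM.
  - exact: commuteV.
  by apply: comS; rewrite inE ?eqxx ?Sa ?orbT.
exists [seq s ^+ i * r | i <- iota 0 p, r <- R] => g gS.
have [i [r Sr ->]] : exists i, exists2 r, r \in generated [set` S] & g = s ^+ i * r.
  elim/generated_ind: g / gS => [|_ _ [i [a Sa ->]] [j [b Sb ->]]|_ [i [a Sa ->]]|a /=].
  - by exists 0%N, 1; rewrite ?gpred1 ?mulg1.
  - exists (i + j)%N, (a * b); first exact: gpredM.
    rewrite expgnDr -!mulgA; congr (_ * _); rewrite !mulgA; congr (_ * _).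
    exact/commuteX/commute_sym/coms.
  - exists (p.-1 * i)%N, a^-1; first by rewrite gpredV.
    have ca : commute (s ^+ i) a by exact/commute_sym/commuteX/commute_sym/coms.
    (* The inverse of s ^+ i is a positive power of s, because s ^+ p = 1. *)
    rewrite ca invgM; congr (_ * _); apply: mulg1_eq.
    by rewrite -expgnDr -mulSn prednK // expgnA sp expg1n.
  rewrite inE => /orP[/eqP->|Sa].
    by exists 1%N, 1; rewrite ?gpred1 ?mulg1.
  by exists 0%N, a; rewrite ?mul1g ?mem_generated.
apply/allpairsP; exists ((i %% p)%N, r); split=> /=.
- by rewrite mem_iota ltn_mod.
- exact: RS.
by rewrite {1}(divn_eq i p) expgnDr mulnC expgnA sp expg1n mul1g.
Qed.
End GeneratedSubgroups.

Section DerivedSeriesTheory.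
Local Open Scope group_scope.
Variable p : nat.

Lemma derived_p_comm (G : groupType) n (a b : G) :
  a \in derived_p G p n -> b \in derived_p G p n -> [~ a, b] \in derived_p G p n.+1.
Proof. by move=> Da Db; apply: mem_generated; left; exists a, b. Qed.

Lemma derived_p_exp (G : groupType) n (a : G) :
  a \in derived_p G p n -> a ^+ p \in derived_p G p n.+1.
Proof. by move=> Da; apply: mem_generated; right; exists a. Qed.

Lemma derived_p_exp_total (G : groupType) n (a : G) : a ^+ (p ^ n) \in derived_p G p n.
Proof.
by elim: n => [//|n IHn]; rewrite expnSr expgnA; exact: derived_p_exp.
Qed.

Lemma derived_p_morph (G H : groupType) (f : {multiplicative G -> H}) n a :
  a \in derived_p G p n -> f a \in derived_p H p n.
Proof.
elim: n a => [//|n IHn] a.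
elim/generated_ind: a / => [|a b|a|a]; rewrite ?multiplicative1 ?gpred1 //.
- by rewrite gmulfM; exact: gpredM.
- by rewrite multiplicativeV gpredV.
case=> [[b [c [Db Dc ->]]]|[b Db ->]].
  by rewrite multiplicativeR; apply: derived_p_comm; exact: IHn.
by rewrite multiplicativeX; apply: derived_p_exp; exact: IHn.
Qed.

Lemma derived_p_surj (G H : groupType) (f : {multiplicative G -> H}) n b :
  (forall b, exists a, f a = b) -> b \in derived_p H p n ->
  exists2 a, a \in derived_p G p n & f a = b.
Proof.
move=> surj; elim: n b => [|n IHn] b; first by have [a <-] := surj b; exists a.
elim/generated_ind: b / => [|_ _ [a Da <-] [b Db <-]|_ [a Da <-]|b].
- by exists 1; rewrite ?multiplicative1 ?gpred1.
- by exists (a * b); rewrite ?gmulfM ?gpredM.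
- by exists a^-1; rewrite ?multiplicativeV ?gpredV.
case=> [[_ [_ [/IHn[a Da <-] /IHn[c Dc <-] ->]]]|[_ /IHn[a Da <-] ->]].
  by exists [~ a, c]; rewrite ?multiplicativeR //; exact: derived_p_comm.
by exists (a ^+ p); rewrite ?multiplicativeX //; exact: derived_p_exp.
Qed.

(** Each term of the series has finite index in the previous one, which is
    finitely generated by [schreier], since the quotient is elementary abelian. *)
Lemma derived_p_fin_index (G : groupType) n :
  (0 < p)%N -> fin_gen (@whole G) -> exists T, covers T (derived_p G p n) (@whole G).
Proof.
move=> p0 fgG; elim: n => [|n [T covT]].
  by exists [:: 1] => g _; exists 1; rewrite ?inE ?eqxx.
have [S SD DS] := schreier fgG covT.
pose c : {multiplicative G -> quotient_group (derived_p G p n.+1)} := @coset _ _.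
have cE a b : c a = c b -> b / a \in derived_p G p n.+1.
  by move/coset_eqP/(gpredJ_all _ a^-1); rewrite /conjg invgK !mulgA mulgV mul1g.
have [a b|a|R genR] := @finite_elementary _ p [seq c s | s <- S] p0.
- case/mapP=> {a}a /SD Da ->; case/mapP=> {b}b /SD Db ->.
  rewrite /commute -!cosetM; apply/coset_eqP.
  by rewrite invgM -mulgA -[_ * (_ * _)]/[~ b, a] derived_p_comm.
- case/mapP=> {a}a /SD Da ->; rewrite -multiplicativeX -[RHS](multiplicative1 c).
  by apply/coset_eqP; rewrite mulg1 gpredV derived_p_exp.
have cS a : a \in derived_p G p n -> c a \in R.
  move=> /DS aS; apply: genR.
  elim/generated_ind: a / aS => [|a b|a|a aS]; rewrite ?multiplicative1 ?gpred1 //.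
  - by rewrite gmulfM; exact: gpredM.
  - by rewrite multiplicativeV gpredV.
  by apply: mem_generated; exact: map_f.
exists [seq repr r * t | r <- R, t <- T] => g _.
have [//|t Tt Dgt] := covT g.
exists (repr (c (g / t)) * t).
  by apply/allpairsP; exists (c (g / t), t); split=> //; exact: cS.
by rewrite invgM mulgA; apply: cE; exact: cosetK.
Qed.
End DerivedSeriesTheory.

Lemma fg_lift_generated (T : choiceType) (G : groupType) (x : T -> G) w :
  fg_lift x w \in generated (range x).
Proof.
rewrite /fg_lift gpred_prod // => -[i b] _; rewrite /letter_val /=.
have xi : x i \in generated (range x) by apply: mem_generated; exists i.
by case: ifP; rewrite ?gpredV.
Qed.

Lemma free_group_fin_gen k : fin_gen (@whole (free_group 'I_k)).
Proof.
exists [seq fg_gen i | i <- enum 'I_k] => // g _.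
have -> : g = fg_lift (@fg_gen _) g by exact: (@fg_lift_unique _ _ _ idfun).
have := fg_lift_generated (@fg_gen 'I_k) g.
move: (fg_lift _ g) => w /asboolP; apply=> _ [i _ <-].
by apply: mem_generated; rewrite /= map_f // mem_enum.
Qed.

(** * Lifting through central extensions of finite p-groups *)

Section OrderPElement.
Import all_fingroup all_solvable.
Local Open Scope group_scope.
Variables (p : nat) (P : finGroupType) (z : P).
Hypotheses (p_pr : prime p) (oz : #[z] = p).

Lemma expg_Fp_nat i : z ^+ (i%:R : 'F_p)%R = z ^+ i.
Proof. by rewrite val_Fp_nat // -oz expg_mod_order. Qed.

Lemma expg_FpD (a b : 'F_p) : z ^+ (a + b)%R = z ^+ a * z ^+ b.
Proof. by rewrite -expgD -[RHS]expg_Fp_nat natrD !natr_Zp. Qed.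

Lemma expg_Fp_inj (a b : 'F_p) : z ^+ a = z ^+ b -> a = b.
Proof.
move/eqP; rewrite eq_expg_mod_order oz -!val_Fp_nat // => /eqP/val_inj.
by rewrite !natr_Zp.
Qed.

Lemma cycle_Fp_log u : u \in <[z]> -> exists a : 'F_p, u = z ^+ a.
Proof. by case/cycleP => i ->; exists (i%:R)%R; rewrite expg_Fp_nat. Qed.

(** The splitting that kills the obstruction: a complement of [<[z]>] in [W]
    gives a projection, read in [F_p] through the exponents of [z]. *)
Lemma abelem_retraction (W : {group P}) : p.-abelem W -> z \in W ->
  exists rho : P -> 'F_p,
    {in W &, forall u v, rho (u * v) = (rho u + rho v)%R} /\
    (forall a : 'F_p, rho (z ^+ a) = a).
Proof.
move=> abW Wz.
have sZW : <[z]> \subset W by rewrite cycle_subG.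
have /splitsP[K compK] := abelem_splits abW sZW.
have [_ defW] := complP compK.
have cZW : W \subset 'C(<[z]>).
  by apply: fintype.subset_trans (centS sZW); exact: abelem_abelian abW.
have cZK : K \subset 'C(<[z]>).
  by apply: fintype.subset_trans cZW; rewrite -defW mulG_subr.
have /choice[rho rhoP] : forall u, exists a : 'F_p, u \in W -> divgr <[z]> K u = z ^+ a.
  move=> u; case: (boolP (u \in W)) => [Wu|_]; last by exists 0%R.
  have [|a aE] := @cycle_Fp_log (divgr <[z]> K u); last by exists a.
  by apply: mem_divgr; rewrite defW.
exists rho; split=> [u v Wu Wv|a].
  apply: expg_Fp_inj; rewrite expg_FpD -!rhoP ?groupM //.
  exact: (divgrM compK).
by apply: expg_Fp_inj; rewrite -rhoP ?groupX // divgr_id // mem_cycle.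
Qed.
End OrderPElement.

Section LastTermAbelem.
Import all_fingroup all_solvable.
Local Open Scope group_scope.
Variables (p m : nat) (P : finGroupType) (z : P).
Hypotheses (p_pr : prime p) (oz : #[z] = p) (zC : forall g, commute z g).
Hypothesis P_solv : forall a : P, a \in derived_p P p m.+1 -> a = 1.

(** The term of index [m] is abelian of exponent [p] because commutators and
    [p]-th powers of its elements lie in the trivial next term; adjoining [z]
    keeps this, because [z] is central of order [p]. *)
Lemma derived_p_abelem_center :
  exists W : {group P}, [/\ p.-abelem W, z \in W &
    forall a : P, a \in derived_p P p m -> a \in W].
Proof.
pose V := [set a : P | a \in derived_p P p m].
have gV : group_set V.
  by apply/group_setP; split=> [|a b]; rewrite !inE ?gpred1 //; exact: gpredM.
pose GV := Group gV.
have cVz : <[z]> \subset 'C(GV).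
  by rewrite cycle_subG; apply/centP => a _; exact: zC.
have cV : abelian GV.
  apply/centsP => a; rewrite inE => Va b; rewrite inE => Vb.
  by apply/commgP/eqP/P_solv/derived_p_comm.
exists (GV <*> <[z]>)%G; split.
- apply/abelemP => //; split.
    by rewrite abelianY cV cycle_abelian.
  move=> a; rewrite -[gval _]/(GV <*> <[z]>) cent_joinEr // => /mulsgP[b c].
  rewrite inE => Vb /cycleP[i ->] ->.
  rewrite expgMn; last exact/commuteX/commute_sym/zC.
  rewrite [b ^+ p]P_solv ?derived_p_exp // mul1g -expgM mulnC expgM.
  by rewrite -oz expg_order expg1n.
- by apply: (fintype.subsetP (joing_subr _ _)); exact: cycle_id.
by move=> a Va; apply: (fintype.subsetP (joing_subl _ _)); rewrite inE.
Qed.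
End LastTermAbelem.

Section LiftCentral.
Import all_fingroup all_solvable.
Local Open Scope group_scope.
Variables (p m k : nat) (B : groupType) (x : 'I_k -> B) (P : finGroupType) (z : P).
Hypothesis p_pr : prime p.
Hypothesis H2_surj : forall y : homology 'F_p B 2,
  exists h : homology 'F_p (subgroup (derived_p B p m)) 2,
    homology_map (@subgroup_val B (derived_p B p m)) h = y.
Hypothesis x_indep : lin_indep (fun i => H1_class 'F_p (x i)).
Hypotheses (oz : #[z] = p) (zC : forall g, commute z g).
Hypothesis P_solv : forall a : P, a \in derived_p P p m.+1 -> a = 1.

Let Z := <[z]>.

Lemma cycle_central_norm (a : P) : a \in 'N(Z).
Proof.
by apply: (fintype.subsetP (cent_sub _)); rewrite cent_cycle; apply/cent1P/commute_sym/zC.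
Qed.

Fact coset_central_morphism : {morph coset Z : a b / a * b}.
Proof. by move=> a b; rewrite morphM ?cycle_central_norm. Qed.

Definition coset_multiplicative : {multiplicative P -> coset_of Z} :=
  HB.pack (coset Z) (isMultiplicative.Build P (coset_of Z) _ coset_central_morphism).

Lemma coset_eq_expg (a b : P) : coset Z a = coset Z b -> exists i : 'F_p, b = z ^+ i * a.
Proof.
move=> ab; have [|i iE] := @cycle_Fp_log p P z p_pr oz (b * a^-1).
  apply: coset_idr; first exact: cycle_central_norm.
  rewrite -[LHS]/(coset_multiplicative (b * a^-1)) gmulfM multiplicativeV.
  by rewrite -[coset_multiplicative a]/(coset Z a) ab; exact: mulgV.
by exists i; rewrite -iE mulgKV.
Qed.

(** A homomorphism to [P / <[z]>] lifts to [P], with prescribed values on the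
    [x i]. Its set-theoretic lift [r] has the discrepancy cocycle [c] with values
    in [F_p]. On the subgroup [D], the term of index [m] of the series of [B], the
    values of [r] lie in the elementary abelian group [W], which splits over
    [<[z]>]; so [c] is a coboundary on [D], hence on [B] by
    [coboundary2_descent], and [r] can be corrected to a homomorphism. What is
    left is to adjust the values on the [x i] by powers of [z], with
    [hom_prescribed]. *)
Lemma lift_central_extension (beta : {multiplicative B -> coset_of Z}) (g : 'I_k -> P) :
  (forall i, beta (x i) = coset Z (g i)) ->
  exists gamma : {multiplicative B -> P}, forall i, gamma (x i) = g i.
Proof.
move=> betax; pose r b := repr (beta b).
have rE b : coset Z (r b) = beta b by exact: coset_reprK.
have zi (i : 'F_p) a : commute (z ^+ i) a by exact/commute_sym/commuteX/commute_sym/zC.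
have /choice[e eP] : forall ab : B * B, exists i : 'F_p,
    r ab.1 * r ab.2 = z ^+ i * r (ab.1 * ab.2).
  case=> a b; apply: coset_eq_expg.
  by rewrite rE gmulfM coset_central_morphism !rE.
pose c a b := e (a, b).
have cE a b : r a * r b = z ^+ c a b * r (a * b) by exact: (eP (a, b)).
have ccoc : cocycle2 c.
  move=> a b d; apply: (expg_Fp_inj p_pr oz); rewrite !(expg_FpD p_pr oz).
  apply: (@mulIg _ (r (a * b * d))).
  transitivity (r a * r b * r d); first by rewrite cE -[LHS]mulgA -[RHS]mulgA cE.
  rewrite -[LHS]mulgA cE [LHS]mulgA -(zi _ (r a)) -[LHS]mulgA cE -[a * b * d]mulgA.
  exact: mulgA.
have [W [abW Wz DW]] := derived_p_abelem_center p_pr oz zC P_solv.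
have [rho [rhoM rhoz]] := abelem_retraction p_pr oz abW Wz.
pose D := subgroup (derived_p B p m).
have rW (a : D) : r (subgroup_val a) \in W.
  have Da : beta (subgroup_val a) \in derived_p (coset_of Z) p m.
    by apply: derived_p_morph; exact: valP.
  have [|u /DW Wu uE] := @derived_p_surj p _ _ coset_multiplicative _ _ _ Da.
    by move=> b; exists (repr b); exact: coset_reprK.
  have [|i ->] := @coset_eq_expg u (r (subgroup_val a)); first by rewrite rE.
  by rewrite groupM ?groupX.
(* Applying the retraction rho to the identity cE, which takes place inside W,
   exhibits c as the coboundary of rho composed with r. *)
have pull : coboundary2 (fun a b : D => c (subgroup_val a) (subgroup_val b)).
  exists (fun a => rho (r (subgroup_val a))) => a b.
  rewrite -rhoM ?rW // cE -subgroup_valM rhoM ?rW ?groupX // rhoz.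
  by rewrite GRing.addrK.
have [s sE] := coboundary2_descent H2_surj ccoc pull.
pose gamma0 b := z ^+ (- s b)%R * r b.
have zswap (i j : 'F_p) a b : z ^+ i * a * (z ^+ j * b) = z ^+ (i + j)%R * (a * b).
  by rewrite (expg_FpD p_pr oz) -!mulgA; congr (_ * _); rewrite !mulgA (zi j a).
have gamma0M : {morph gamma0 : a b / a * b}.
  move=> a b; rewrite /gamma0 zswap cE mulgA -(expg_FpD p_pr oz).
  by congr (z ^+ _ * _); congr (val _); rewrite sE; ring.
have /choice[t tE] : forall i, exists j : 'F_p, g i = z ^+ j * gamma0 (x i).
  move=> i; apply: coset_eq_expg; rewrite -betax coset_central_morphism rE.
  by rewrite coset_id ?mul1g // mem_cycle.
have [chi [chiM chix]] := hom_prescribed t x_indep.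
pose gamma b := z ^+ chi b * gamma0 b.
have gammaM : {morph gamma : a b / a * b}.
  by move=> a b; rewrite /gamma zswap -chiM -gamma0M.
pose gammaU : {multiplicative B -> P} :=
  HB.pack gamma (isMultiplicative.Build B P gamma gammaM).
by exists gammaU => i; rewrite /gammaU /= /gamma chix -tE.
Qed.
End LiftCentral.

Section Extension.
Import all_fingroup all_solvable.
Local Open Scope group_scope.
Variables (p m k : nat) (B : groupType) (x : 'I_k -> B).
Hypothesis p_pr : prime p.
Hypothesis H2_surj : forall y : homology 'F_p B 2,
  exists h : homology 'F_p (subgroup (derived_p B p m)) 2,
    homology_map (@subgroup_val B (derived_p B p m)) h = y.
Hypothesis x_indep : lin_indep (fun i => H1_class 'F_p (x i)).

Lemma derived_p_trivial_pgroup (P : finGroupType) n :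
  (forall a : P, a \in derived_p P p n -> a = 1) -> p.-group [set: P].
Proof.
move=> solvP; apply/pgroupP => q q_pr /Cauchy[//|a _ oa].
have : #[a] %| p ^ n by rewrite order_dvdn; apply/eqP/solvP/derived_p_exp_total.
by rewrite oa Euclid_dvdX // dvdn_prime2 // => /andP[/eqP-> _]; rewrite inE.
Qed.

(** Induction on the order: [P] is a [p]-group, so that, unless it is trivial, it
    has a central element [z] of order [p], and [P / <[z]>] satisfies the same
    hypothesis because the series of a quotient is the image of the series. *)
Lemma extend_to_finite (P : finGroupType) (g : 'I_k -> P) :
  (forall a : P, a \in derived_p P p m.+1 -> a = 1) ->
  exists gamma : {multiplicative B -> P}, forall i, gamma (x i) = g i.
Proof.
have [N] := ubnP #|P|; elim: N P g => // N IHN P g leN solvP.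
have [trivP|ntP] := eqVneq [set: P] 1.
  have tM : {morph (fun=> 1 : P) : a b / (a * b : B) >-> (a * b : P)}.
    by move=> a b; rewrite mulg1.
  pose t : {multiplicative B -> P} :=
    HB.pack (fun _ : B => 1 : P) (isMultiplicative.Build B P _ tM).
  by exists t => i; have := finset.in_setT (g i); rewrite trivP => /set1P->.
have pP := derived_p_trivial_pgroup solvP.
have pZ : p.-group 'Z([set: P]) := pgroupS (center_sub _) pP.
have [|_ pdZ _] := pgroup_pdiv pZ; first by rewrite center_nil_eq1 ?(pgroup_nil pP).
have [z /centerP[_ zC] oz] := Cauchy p_pr pdZ.
have {}zC a : commute z a by apply: zC; rewrite inE.
have ltPz : #|{: coset_of <[z]>}| < #|P|.
  rewrite -!cardsT -quotientT ltn_quotient ?subsetT // -cardG_gt1.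
  by rewrite -[#|_|]/#[z] oz prime_gt1.
have [a|beta betaE] :=
  IHN (coset_of <[z]>) (fun i => coset <[z]> (g i)) (leq_trans ltPz leN).
  case/(@derived_p_surj p _ _ (coset_multiplicative zC)) => [b|b /solvP-> <-].
    by exists (repr b); exact: coset_reprK.
  exact: (multiplicative1 (coset_multiplicative zC)).
exact: (lift_central_extension p_pr H2_surj x_indep oz zC solvP betaE).
Qed.
End Extension.

(** * The quotient of the free group *)

Section FiniteGroups.
Import all_fingroup.
Local Open Scope group_scope.

(** The equality is one of group structures, so that statements about finite
    groups transfer by rewriting. *)
Lemma finite_group_fingroup (G : groupType) (R : seq G) :
  (forall g : G, g \in R) -> exists P : finGroupType, P = G :> groupType.
Proof.
move=> allR.
have indexK : pcancel (index^~ R) (fun i => Some (nth 1 R i)).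
  by move=> g; rewrite nth_index.
have enumR : Finite.axiom (undup R).
  by move=> g; rewrite count_uniq_mem ?undup_uniq // mem_undup allR.
pose P : finGroupType :=
  HB.pack (Group.sort G) (Group.class G) (PCanIsCountable indexK)
    (isFinite.Build G enumR).
by exists P; rewrite {}/P; case: G R allR indexK enumR => T [].
Qed.

Lemma extend_to_finite_group p m k (B : groupType) (x : 'I_k -> B)
    (Q : groupType) (R : seq Q) (g : 'I_k -> Q) :
  prime p ->
  (forall y : homology 'F_p B 2,
    exists h : homology 'F_p (subgroup (derived_p B p m)) 2,
      homology_map (@subgroup_val B (derived_p B p m)) h = y) ->
  lin_indep (fun i => H1_class 'F_p (x i)) ->
  (forall q : Q, q \in R) ->
  (forall a : Q, a \in derived_p Q p m.+1 -> a = 1) ->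
  exists gamma : {multiplicative B -> Q}, forall i, gamma (x i) = g i.
Proof.
move=> p_pr H2_surj x_indep /finite_group_fingroup[P PQ]; case: _ / PQ g => g.
exact: (extend_to_finite p_pr H2_surj x_indep).
Qed.
End FiniteGroups.

Theorem corollary4p8 (B : groupType) (p n k : nat) (x : 'I_k -> B) :
  finitely_presented B -> prime p -> (1 <= n)%N ->
  (forall y : homology 'F_p B 2,
     exists z : homology 'F_p (subgroup (derived_p B p n.-1)) 2,
       homology_map (@subgroup_val B (derived_p B p n.-1)) z = y) ->
  lin_indep (fun i => H1_class 'F_p (x i)) ->
  exists f : {multiplicative subgroup (generated (range x))
              -> quotient_group (derived_p (free_group 'I_k) p n)},
    forall y, exists a, f a = y.
Proof.
move=> _ p_pr; case: n => // m _ H2_surj x_indep.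
pose F := free_group 'I_k; pose D := derived_p F p m.+1.
have [T covT] := derived_p_fin_index m.+1 (prime_gt0 p_pr) (free_group_fin_gen k).
have allQ (q : quotient_group D) : q \in [seq coset D t | t <- T].
  have [//|t Tt Dqt] := covT (repr q).
  apply/mapP; exists t => //; rewrite -[LHS]cosetK; apply/esym/coset_eqP.
  by have := gpredJ_all _ t Dqt; rewrite /conjg mulgVK.
have cosetS (q : quotient_group D) : exists w, coset D w = q.
  by exists (repr q); exact: cosetK.
have solvQ (q : quotient_group D) : q \in derived_p _ p m.+1 -> q = 1%g.
  case/(derived_p_surj (f := @coset F D) cosetS) => w Dw <-.
  rewrite -(multiplicative1 (@coset F D)); apply/esym/coset_eqP.
  by rewrite invg1 mul1g.
have [gamma gammaE] := extend_to_finite_group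
  (fun i => coset D (fg_gen i)) p_pr H2_surj x_indep allQ solvQ.
pose A := subgroup (generated (range x)).
pose f : {multiplicative A -> quotient_group D} := gamma \o @subgroup_val B _.
exists f => q; have [w <-] := cosetS q.
exists (Subgroup (fg_lift_generated x w)); rewrite /f /=.
(* Both gamma after fg_lift x and the projection F -> F / D are homomorphisms
   that agree on the generators. *)
rewrite (fg_lift_unique (f := @coset F D) (fun=> erefl)).
rewrite -[LHS]/((gamma \o fg_lift x) w).
apply: (fg_lift_unique (f := gamma \o fg_lift x)) => i.
by rewrite /= fg_lift_gen gammaE.
Qed.
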